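(* Let $k$ be a number field, $G$ a finite abelian group and $\mathcal{A}\subset k^*$ a finitely generated subgroup. Then there exists an abelian extension $K/k$ with Galois group $G$ such that every element of $\mathcal{A}$ is a norm from $K$, i.e. $\mathcal{A}\subset N_{K/k}(K^* )$.
   Context: An element $\alpha\in k^*$ is a norm from $K$ if $\alpha\in N_{K/k}(K^* )$, where $N_{K/k}:K^*\to k^*$ is the field norm. *)

(* Defs.v *)
From HB Require Import structures.
From mathcomp Require Import all_boot all_order all_algebra all_fingroup all_field.

Set Implicit Arguments.
Unset Strict Implicit.
Unset Printing Implicit Defensive.

Import GRing.Theory.
Local Open Scope ring_scope.

(* Subgroups of k^* are Prop-valued predicates on k that exclude 0: unlike     *)
(* {pred k}, this does not require membership to be decidable.                 *)
Definition mul_subgroup (k : fieldType) (A : k -> Prop) : Prop :=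
  [/\ forall a, A a -> a != 0,
      A 1
    & forall a b, A a -> A b -> A (a / b)].

Definition mul_generated (k : fieldType) (s : seq k) (a : k) : Prop :=
  forall B : k -> Prop, mul_subgroup B -> (forall x, x \in s -> B x) -> B a.

(* The generators are required to be nonzero: otherwise no subgroup of k^*     *)
(* contains them all and mul_generated s is all of k.                          *)
Definition fg_mul_subgroup (k : fieldType) (A : k -> Prop) : Prop :=
  mul_subgroup A /\
  exists s : seq k,
    0 \notin s /\ forall a, A a <-> mul_generated s a.

Definition abelian_extension (k : fieldType) (K : splittingFieldType k) : Prop :=
  galois 1%AS {:K}%AS /\ abelian 'Gal({:K}%AS / 1%AS).

(* galNorm, the product of the conjugates over Gal(K/k), is the field norm when *)
(* K/k is Galois (the only case used). It takes its values in K, so a in k is  *)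
(* compared through its image a%:A.                                            *)
Definition is_norm_from (k : fieldType) (K : splittingFieldType k) (a : k) : Prop :=
  exists2 b : K, b != 0 & galNorm 1%AS {:K}%AS b = a%:A.

(* Main.v *)
Require Import Defs.
From HB Require Import structures.
From mathcomp Require Import all_boot all_order all_algebra all_fingroup all_field.
From mathcomp Require Import all_solvable ring zify.
From Stdlib Require Import Classical_Prop.

Set Implicit Arguments.
Unset Strict Implicit.
Unset Printing Implicit Defensive.

Import GRing.Theory Num.Theory AEnd_FinGroup.
Local Open Scope ring_scope.

(** K is built one cyclic factor of G at a time, starting from k.  Suppose that
    a field K1 has been reached, with elements b_i to be turned into norms, and
    that the next factor is cyclic of order n.  Take a number field L, Galois
    over Q, that contains K1, a primitive n-th root of unity and n-th roots
    alpha_i of the b_i.  For xi in L^* let chi be the corestriction to Q of the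
    Kummer character of xi over L.  Since b_i is an n-th power in L, the symbol
    (xi, b_i) vanishes over L, so by the projection formula the cup product of
    chi with b_i vanishes over K1: b_i is a norm from the extension of K1 cut
    out by chi.  No cohomology is needed, because the element of norm b_i can be
    written down as a quotient of two Lagrange resolvents; the norm condition at
    the next step is then imposed on these new elements.  It remains to choose
    xi such that chi is onto already over L, i.e. such that a certain product of
    powers of conjugates of xi is not a p-th power in L for p | n; this is
    achieved with a degree one prime of L, modulo which xi is a primitive root
    and its other conjugates are 1. *)

(** * Degree one primes of number fields *)

Lemma poly_nonroot (R : idomainType) (p : {poly R}) (u : nat -> R) :
  p != 0 -> injective u -> exists z, p.[u z] != 0.
Proof.
move=> p0 uI; have := @max_poly_roots _ p [seq u z | z <- iota 0 (size p)] p0.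
case: (boolP (all _ _)) => [_|].
  by rewrite map_inj_uniq ?iota_uniq // size_map size_iota ltnn => /(_ isT isT).
by rewrite -has_predC => /hasP[_ /mapP[z _ ->]] /= pz _; exists z.
Qed.

(** Euclid's argument: a prime factor of a value of [f] is kept away from [N] by making a cofactor
    congruent to 1 modulo [N]. At an integer root of [f], any prime above the absolute value of [N]
    serves. *)
Lemma prime_dvd_value (f : {poly int}) (N : int) : (1 < size f)%N -> N != 0 ->
  exists l c, [/\ prime l, ~~ (l %| N)%Z & (l %| f.[c])%Z].
Proof.
move=> sf N0.
have root_case c : f.[c] = 0 ->
    exists l c, [/\ prime l, ~~ (l %| N)%Z & (l %| f.[c])%Z].
  move=> fc; have [l lN pl] := prime_above `|N|; exists l, c.
  rewrite pl fc dvdz0 dvdzE; split=> //; apply/negP => /dvdn_leq.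
  by rewrite absz_gt0 N0 => /(_ isT); rewrite leqNgt lN.
have [f0|f0] := eqVneq f.[0] 0; first exact: root_case f0.
set a := f.[0] in f0.
have [h fE] : exists h, f = h * 'X + a%:P.
  have /factor_theorem[h hE] : root (f - a%:P) 0 by rewrite /root !hornerE subrr.
  by exists h; rewrite -[f](subrK a%:P) hE polyC0 subr0.
have nz e : f + e%:P != 0.
  rewrite -size_poly_gt0 size_polyDl ?(leq_ltn_trans (size_polyC_leq1 e) sf) //.
  exact: ltn_trans sf.
have uI : injective (fun z : nat => a * N * z%:Z).
  by move=> x y /(mulfI (mulf_neq0 f0 N0)) [].
(* The point [a * N * z] avoids the roots of [f - a] and [f + a], so that the cofactor [m] below is
   neither 1 nor -1. *)
have [z] := poly_nonroot (mulf_neq0 (nz (- a)) (nz a)) uI.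
(* f takes at c = f(0) N z the value f(0) m with m = 1 modulo N. *)
set c := _ * z%:Z => Hc.
pose m := 1 + N * z%:Z * h.[c].
have fc : f.[c] = a * m.
  rewrite {1}fE !hornerE /m; move: h.[c] => y; rewrite /c /=.
  by ring.
have [m0|m0] := eqVneq m 0; first by apply: (root_case c); rewrite fc m0 mulr0.
have m1 : (1 < `|m|)%N.
  have m1 : `|m|%N != 1%N.
    apply: contraNneq Hc => m1; rewrite !hornerE fc.
    have -> : (a * m - a) * (a * m + a) = a ^+ 2 * (m ^+ 2 - 1) by ring.
    have -> : m ^+ 2 = 1 by move: m1; clear; lia.
    by rewrite subrr mulr0.
  by move: m0 m1; clear; lia.
exists (pdiv `|m|), c; rewrite pdiv_prime // fc; split=> //.
  apply/negP => lN; have lm : (pdiv `|m| %| m)%Z by rewrite dvdzE pdiv_dvd.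
  have : (pdiv `|m| %| m - N * (z%:Z * h.[c]))%Z by rewrite rpredB ?dvdz_mulr.
  have -> : m - N * (z%:Z * h.[c]) = 1 by rewrite /m -mulrA addrK.
  rewrite dvdz1 /= => /eqP e.
  by have := prime_gt1 (pdiv_prime m1); rewrite e.
by rewrite dvdz_mull // dvdzE pdiv_dvd.
Qed.

Lemma horner_taylor2 (R : comNzRingType) (p : {poly R}) (x y : R) :
  exists q, p.[x + y] = p.[x] + y * (p^`()).[x] + y ^+ 2 * q.
Proof.
elim/poly_ind: p => [|p b [q IH]].
  by exists 0; rewrite deriv0 !horner0; ring.
exists (q * (x + y) + (p^`()).[x]).
by rewrite derivE !hornerE IH /=; ring.
Qed.

(** Newton iteration: the class of [d] modulo [l] never changes, so f'(d) stays invertible modulo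
    [l]. *)
Lemma hensel (l : nat) (f : {poly int}) (c : int) : prime l ->
  (l %| f.[c])%Z -> ~~ (l %| (f^`()).[c])%Z ->
  forall M, exists2 d : int, (l %| d - c)%Z & (l%:Z ^+ M.+1 %| f.[d])%Z.
Proof.
move=> pl fc f'c; elim=> [|M [d dc /dvdzP[e fd]]].
  by exists c; rewrite ?subrr ?dvdz0 ?expr1.
have f'd : coprimez (f^`()).[d] l.
  rewrite coprimezE coprime_sym prime_coprime //; apply: contra f'c.
  move=> f'd; have {}f'd : (l %| (f^`()).[d])%Z by rewrite dvdzE.
  have [q Hq] := horner_taylor2 f^`() c (d - c).
  move: f'd; rewrite -[d](subrK c) (addrC _ c) Hq expr2 -addrA.
  by rewrite rpredDr // rpredD // ?dvdz_mulr // -mulrA dvdz_mulr.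
case/coprimezP: f'd => -[u v] /= uv.
(* With f(d) = e l^(M+1) and u f'(d) + v l = 1, the linear term of this correction reduces f(d) to e
   v l^(M+2). *)
exists (d + l%:Z ^+ M.+1 * (- e * u)).
  by rewrite addrAC rpredD // dvdz_mulr // exprS dvdz_mulr.
have [q ->] := horner_taylor2 f d (l%:Z ^+ M.+1 * (- e * u)).
rewrite fd rpredD //.
  have -> : e * l%:Z ^+ M.+1 + l%:Z ^+ M.+1 * (- e * u) * (f^`()).[d] =
    e * l%:Z ^+ M.+1 * (1 - u * (f^`()).[d]) by ring.
  rewrite -uv (_ : _ * _ = e * v * (l%:Z ^+ M.+1 * l%:Z)); last by ring.
  by rewrite -exprSr dvdz_mull.
rewrite exprMn -mulrA dvdz_mulr // -exprM dvdz_exp2l // muln2 -addnn.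
by rewrite addSnnS leq_addl.
Qed.

(** Elements written as A(theta)/B with [A] and [B] integral can be reduced modulo a prime. The
    primitive element is found for the image of a basis in [algC]. *)
Lemma int_primitive_element (L : fieldExtType rat) (LC : {rmorphism L -> algC}) :
  exists theta : L, forall x : L, exists (A : {poly int}) (B : int),
    B != 0 /\ B%:~R * x = (map_poly intr A).[theta].
Proof.
pose b := vbasis {:L}.
have [z [a Dz] [ps Dps]] := algC_PET (map LC b).
have sz : size (map LC b) = \dim {:L} by rewrite size_map size_tuple.
pose theta := \sum_(i < size (map LC b)) b`_i *+ a i.
have thetaC : LC theta = z.
  rewrite Dz rmorph_sum; apply: eq_bigr => i _.
  by rewrite rmorphMn /= (nth_map 0) // -(size_map LC).
have LCh p : LC (map_poly (in_alg L) p).[theta] = (map_poly ratr p).[z].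
  rewrite -horner_map -map_poly_comp thetaC; congr _.[_].
  by apply: eq_map_poly => c /=; rewrite rmorphZ_num rmorph1 mulr1.
exists theta => x.
have [p ->] : exists p, x = (map_poly (in_alg L) p).[theta].
  have szp : size ps = \dim {:L} by rewrite -sz Dps size_map.
  exists (\sum_(i < \dim {:L}) coord b i x *: ps`_i).
  rewrite [LHS](coord_vbasis (memvf x)) (rmorph_sum (map_poly (in_alg L))) horner_sum.
  apply: eq_bigr => i _.
  rewrite -mul_polyC rmorphM /= map_polyC hornerM hornerC /= mulr_algl; congr (_ *: _).
  apply: (fmorph_inj LC); rewrite LCh -[LC _](nth_map 0 0) ?size_tuple // Dps.
  by rewrite (nth_map 0) ?szp.
have [A [B B0 ->]] := rat_poly_scale p; exists A, B; split=> //.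
rewrite -mul_polyC rmorphM /= map_polyC hornerM hornerC /= mulrA.
rewrite -[B%:~R](rmorph_int (in_alg L)) -rmorphM.
rewrite mulfV ?intr_eq0 // rmorph1 mul1r -map_poly_comp; congr _.[_].
by apply: eq_map_poly => c /=; rewrite alg_num_field ratr_int.
Qed.

(** An integral multiple of the minimal polynomial is made primitive; by Gauss's lemma, division by
    it then stays over the integers. *)
Lemma min_int_poly (L : fieldExtType rat) (LC : {rmorphism L -> algC}) (x : L) :
  exists f : {poly int}, [/\ (1 < size f)%N, (map_poly intr f).[x] = 0
    & forall A, (map_poly intr A).[x] = 0 -> exists h, A = h * f].
Proof.
have [p [pE pm] pP] := minCpolyP (LC x).
have [q [a a0 Dp]] := rat_poly_scale p.
have xC (A : {poly int}) : ((map_poly intr A).[x] == 0) = (q %| A).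
  rewrite -(fmorph_eq0 LC) -horner_map -map_poly_comp -dvdp_rat_int.
  rewrite -(dvdpZl _ _ (c := a%:~R^-1)) ?invr_eq0 ?intr_eq0 // -Dp -pP.
  rewrite -map_poly_comp rootE; congr (_.[_] == 0).
  by apply: eq_map_poly => c /=; rewrite rmorph_int ratr_int.
have sq : (1 < size q)%N.
  have : root (minCpoly (LC x)) (LC x) by apply: root_minCpoly.
  move/root_size_gt1; rewrite pE map_poly_eq0 monic_neq0 // => /(_ isT).
  rewrite size_map_poly Dp size_scale ?invr_eq0 ?intr_eq0 // size_map_inj_poly //.
  by move=> ? ? /intr_inj.
exists (zprimitive q); split.
- by rewrite size_zprimitive.
- apply/eqP; rewrite xC {1}[q]zpolyEprim dvdpZl // zcontents_eq0.
  by rewrite -size_poly_gt0 ltnW.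
by move=> A /eqP; rewrite xC => /dvdpP_int[r ->]; exists r; rewrite mulrC.
Qed.

(* [red x u]: x is integral at a degree one prime above l and has residue u.
   The last property holds because this prime is unramified: a root of a unit
   equals, up to a power of l, a unit. *)
Lemma degree_one_place (L : fieldExtType rat) (LC : {rmorphism L -> algC}) (Z : seq L) :
  exists (l : nat) (red : L -> 'F_l -> Prop),
  [/\ prime l, forall x u v, red x u -> red x v -> u = v
    & [/\ forall i : int, red i%:~R i%:~R,
       forall x y u v, red x u -> red y v -> red (x + y) (u + v),
       forall x y u v, red x u -> red y v -> red (x * y) (u * v),
       forall x, x \in Z -> exists u, red x u
     & forall p y t u, (0 < p)%N -> red t u -> u != 0 -> y ^+ p = t ->
         exists v, v ^+ p = u]].
Proof.
have [theta thetaP] := int_primitive_element LC.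
have [f [sf ftheta fmin]] := min_int_poly LC theta.
have df : (map_poly intr f^`()).[theta] != 0.
  apply/eqP => /fmin[h f'E].
  have f0 : f != 0 by rewrite -size_poly_gt0 ltnW.
  have := lt_size_deriv f0; rewrite f'E.
  have [h0|h0] := eqVneq h 0; last first.
    rewrite size_mul //; move: h0 sf; rewrite -size_poly_gt0.
    by move: (size h) (size f); lia.
  have := coef_deriv f (size f).-2; rewrite f'E h0 mul0r coef0.
  have -> : (size f).-2.+1 = (size f).-1 by move: sf; case: (size f) => [|[]].
  move/esym/eqP; rewrite mulrn_eq0 -lead_coefE lead_coef_eq0 (negPf f0) orbF.
  by move: sf; case: (size f) => [|[]].
pose ev (A : {poly int}) : L := (map_poly intr A).[theta].
have evD A B : ev (A + B) = ev A + ev B by rewrite /ev rmorphD hornerD.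
have evM A B : ev (A * B) = ev A * ev B by rewrite /ev rmorphM hornerM.
have evC (a : int) : ev a%:P = a%:~R by rewrite /ev map_polyC hornerC.
(* [N] is a common denominator for [Z] and for the inverse of f'(theta); the latter makes [c] below
   a simple root of [f] modulo [l]. *)
have [N N0 NP] : exists2 N : int, N != 0 & forall x, x \in (ev f^`())^-1 :: Z ->
    exists A (B : int), B%:~R * x = ev A /\ (B %| N)%Z.
  elim: (_ :: Z) => [|x s [N N0 IH]]; first by exists 1.
  have [A [B [B0 AB]]] := thetaP x; exists (B * N); first exact: mulf_neq0.
  move=> y /[1!inE] /predU1P[->|/IH[A' [B' [? ?]]]].
    by exists A, B; rewrite dvdz_mulr.
  by exists A', B'; rewrite dvdz_mull.
(* The degree one prime sends [theta] to [c] modulo [l]. This is consistent because integral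
   relations at [theta] are multiples of [f]. *)
have [l [c [pl lN fc]]] := prime_dvd_value sf N0.
have F0 (i : int) : (l %| i)%Z = (i%:~R == 0 :> 'F_l) by rewrite (dvdz_pcharf (pchar_Fp pl)).
pose red x (u : 'F_l) := exists A (B : int),
  [/\ B%:~R != 0 :> 'F_l, B%:~R * x = ev A & (A.[c])%:~R = B%:~R * u].
have ev0 A : ev A = 0 -> (A.[c])%:~R = 0 :> 'F_l.
  by move=> /fmin[h ->]; apply/eqP; rewrite -F0 hornerM dvdz_mull.
exists l, red; split=> //.
  move=> x u v [A [B [B0 AB Au]]] [A' [B' [B0' AB' Au']]].
  apply: (mulfI B0'); apply: (mulfI B0); rewrite mulrCA -Au -Au' -!rmorphM.
  apply/eqP; rewrite -subr_eq0 -rmorphB; apply/eqP.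
  have := ev0 (B'%:P * A - B%:P * A'); rewrite !hornerE /=; apply.
  by rewrite evD -mulNr -polyCN !evM !evC -AB -AB' rmorphN; ring.
have redl x : x \in (ev f^`())^-1 :: Z -> exists u, red x u.
  move=> /NP[A [B [AB BN]]].
  have B0 : B%:~R != 0 :> 'F_l.
    by rewrite -F0; apply: contra lN => /dvdz_trans; apply.
  by exists (A.[c]%:~R / B%:~R), A, B; split=> //; rewrite mulrC divfK.
split.
- by move=> i; exists i%:P, 1; rewrite oner_eq0 evC hornerC !mul1r.
- move=> x y u v [A [B [B0 AB Au]]] [A' [B' [B0' AB' Au']]].
  exists (B'%:P * A + B%:P * A'), (B * B'); split.
  + by rewrite rmorphM mulf_neq0.
  + by rewrite evD !evM !evC -AB -AB' rmorphM /=; ring.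
  + by rewrite !hornerE rmorphD /= !rmorphM /= Au Au'; ring.
- move=> x y u v [A [B [B0 AB Au]]] [A' [B' [B0' AB' Au']]].
  exists (A * A'), (B * B'); split.
  + by rewrite rmorphM mulf_neq0.
  + by rewrite !evM -AB -AB' rmorphM /=; ring.
  + by rewrite !hornerE /= !rmorphM /= Au Au'; ring.
- by move=> x Zx; apply: redl; rewrite inE Zx orbT.
have f'c : ~~ (l %| (f^`()).[c])%Z.
  have [u [A [B [B0 AB Au]]]] := redl _ (mem_head _ _).
  have /ev0 : ev (A * f^`() - B%:P) = 0.
    by rewrite evD -polyCN evM !evC -AB divfK // rmorphN subrr.
  rewrite !hornerE /= rmorphB /= rmorphM /= => /eqP; rewrite subr_eq0 => /eqP H.
  by rewrite F0; apply: contra_neq B0 => f'0; rewrite -H f'0 mulr0.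
move=> p y t u p0 [A [B [B0 AB Au]]] u0 yt.
have [q [D [D0 qD]]] := thetaP y; rewrite -/(ev q) in qD.
(* The denominator [D] of [y] may be divisible by [l]; its [l]-part l^k has to be cancelled. *)
have [k [D' [D'0 DE]]] : exists k (D' : int), ~~ (l %| D')%Z /\ D = l%:Z ^+ k * D'.
  pose k := logn l `|D|; have Dk : (l%:Z ^+ k %| D)%Z.
    by rewrite dvdzE abszX pfactor_dvdnn.
  exists k, (D %/ l%:Z ^+ k)%Z; rewrite mulrC divzK //; split=> //.
  apply/negP => /dvdzP[D' D'E].
  have : (l ^ k.+1 %| `|D|)%N.
    by rewrite -[D](divzK Dk) D'E -mulrA -exprS abszM abszX dvdn_mull.
  by rewrite pfactor_dvdn ?absz_gt0 // ltnn.
(* At precision kp+1, the relation B q(d)^p = D^p A(d) shows that l^k divides q(d), and a congruence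
   modulo [l] survives the division by l^(kp). *)
have [d dc fd] := hensel pl fc f'c (k * p).
have [h hE] : exists h, B%:P * q ^+ p - (D ^+ p)%:P * A = h * f.
  apply: fmin; rewrite -/(ev _) evD -mulNr -polyCN !evM !evC -AB rmorphN rmorphXn /=.
  have -> : ev (q ^+ p) = D%:~R ^+ p * t.
    by rewrite -yt -exprMn qD /ev rmorphXn horner_exp.
  by ring.
have ld : (l%:Z ^+ (k * p).+1 %| B * q.[d] ^+ p - D ^+ p * A.[d])%Z.
  by have := congr1 (fun P => P.[d]) hE; rewrite !hornerE /= => ->; rewrite dvdz_mull.
have Ad : A.[d]%:~R = A.[c]%:~R :> 'F_l.
  apply/eqP; rewrite -subr_eq0 -rmorphB -F0.
  have [r] := horner_taylor2 A c (d - c); rewrite addrC subrK => ->.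
  have -> : A.[c] + (d - c) * (A^`()).[c] + (d - c) ^+ 2 * r - A.[c] =
    (d - c) * ((A^`()).[c] + (d - c) * r) by ring.
  exact: dvdz_mulr.
have lB : coprimez l B by rewrite coprimezE prime_coprime // -(dvdzE l) F0.
have lqp : (l%:Z ^+ (k * p) %| q.[d] ^+ p)%Z.
  rewrite -(@Gauss_dvdzr _ B) ?coprimezXl //.
  rewrite -[B * _](subrK (D ^+ p * A.[d])) rpredD //.
    by apply: dvdz_trans ld; rewrite exprS dvdz_mull.
  by rewrite DE exprMn -exprM -mulrA dvdz_mulr.
have /dvdzP[e qe] : (l%:Z ^+ k %| q.[d])%Z.
  by move: lqp; rewrite exprM !dvdzE !abszX dvdn_pexp2r.
have : (l %| B * e ^+ p - D' ^+ p * A.[d])%Z.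
  have l0 : l%:Z ^+ (k * p) != 0 by rewrite expf_neq0 //; case: (l) pl.
  rewrite -(dvdz_mul2l l0) -exprSr.
  have -> : l%:Z ^+ (k * p) * (B * e ^+ p - D' ^+ p * A.[d]) =
      B * q.[d] ^+ p - D ^+ p * A.[d]; last exact: ld.
  by rewrite qe DE !exprMn -exprM; ring.
rewrite F0 rmorphB subr_eq0 !rmorphM /= Ad Au mulrCA => /eqP.
move/(mulfI B0); rewrite !rmorphXn => H.
exists (e%:~R / D'%:~R); rewrite expr_div_n H mulrC mulKf //.
by rewrite expf_neq0 // -F0.
Qed.

(** * Non-powers among products of conjugates *)

Lemma AEnd_int_poly (L : splittingFieldType rat) (s : 'AEnd(L)) (A : {poly int}) x :
  s (map_poly intr A).[x] = (map_poly intr A).[s x].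
Proof.
rewrite -horner_map -map_poly_comp; congr _.[_]; apply: eq_map_poly => c /=.
by rewrite rmorph_int.
Qed.

Lemma AEnd_separating (L : splittingFieldType rat) (LC : {rmorphism L -> algC}) :
  exists theta : L, injective (fun g : 'AEnd(L) => g theta).
Proof.
have [theta thetaP] := int_primitive_element LC; exists theta => s t st.
apply/val_inj/lfunP => x; change (s x = t x).
have [A [B [B0 AB]]] := thetaP x.
have B0' : B%:~R != 0 :> L by rewrite -(fmorph_eq0 LC) rmorph_int intr_eq0.
have sM (u : 'AEnd(L)) : u (B%:~R * x) = B%:~R * u x by rewrite rmorphM rmorph_int.
by apply: (mulfI B0'); rewrite -!sM AB !AEnd_int_poly st.
Qed.

Lemma prim_root_neq0 (F : fieldType) n (z : F) : n.-primitive_root z -> z != 0.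
Proof.
move=> zP; apply: contraTneq (oner_neq0 F) => z0.
by rewrite -(prim_expr_order zP) z0 expr0n gtn_eqF ?(prim_order_gt0 zP) ?eqxx.
Qed.

(** The product reduces to g^(m 1), where g is a primitive root modulo l. Were it a p-th power, so
    would be g^(m 1) modulo l; but m 1 = 1 modulo n, and p divides n, which divides l - 1. *)
Lemma non_power_exists (L : splittingFieldType rat) (LC : {rmorphism L -> algC})
    (n : nat) (zeta : L) (m : 'AEnd(L) -> nat) :
  n.-primitive_root zeta -> zeta ^+ m 1%g = zeta ->
  exists2 xi : L, xi != 0 & forall p y, prime p -> (p %| n)%N ->
    \prod_(s : 'AEnd(L)) s xi ^+ m s != y ^+ p.
Proof.
move=> zetaP m1; have [theta thetaI] := AEnd_separating LC.
have fixtheta (s : 'AEnd(L)) : s theta = theta -> s = 1%g.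
  by move=> sth; apply: thetaI; rewrite sth /= id_lfunE.
(* The inverses in Z force the corresponding differences to be units. *)
pose Z := codom (fun s : 'AEnd(L) => s theta) ++
  codom (fun s : 'AEnd(L) => (theta - s theta)^-1) ++
  zeta :: zeta^-1 :: [seq (zeta ^+ i.+1 - 1)^-1 | i <- iota 0 n.-1].
have [l [red [pl redf [redi redD redM redZ redX]]]] := degree_one_place LC Z.
have red1 : red 1 1 by exact: (redi 1).
have redV x u : x != 0 -> x^-1 \in Z -> red x u -> u != 0.
  move=> x0 /redZ[v xv] xu; apply: contraTneq (oner_neq0 'F_l) => u0.
  rewrite negbK; apply/eqP; apply: redf red1 _.
  by rewrite -(mulfV x0) -(mul0r v) -u0; apply: redM.
have redXn x u k : red x u -> red (x ^+ k) (u ^+ k).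
  by move=> xu; elim: k => [|k IH]; rewrite ?expr0 // !exprS; apply: redM.
have redP (I : Type) (r : seq I) (P : pred I) (x : I -> L) (u : I -> 'F_l) :
    (forall i, P i -> red (x i) (u i)) ->
    red (\prod_(i <- r | P i) x i) (\prod_(i <- r | P i) u i).
  by move=> xu; apply: big_ind2 => // *; apply: redM.
have /fin_all_exists[c cP] (s : 'AEnd(L)) : exists c : int, red (s theta) c%:~R.
  have [|u su] := redZ (s theta); first by rewrite mem_cat codom_f.
  by exists (nat_of_ord u); rewrite -pmulrn natr_Zp.
have redB x u (i : int) : red x u -> red (x - i%:~R) (u - i%:~R).
  by move=> xu; rewrite -!mulrNz; apply: redD.
have [v zv] : exists v, red zeta v by apply: redZ; rewrite !mem_cat mem_head !orbT.
have n0 := prim_order_gt0 zetaP.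
have zeta0 : zeta != 0 by exact: prim_root_neq0 zetaP.
have v1 : v ^+ n = 1.
  by apply: redf red1; rewrite -(prim_expr_order zetaP); apply: redXn.
have v0 : v != 0.
  apply: (redV zeta) => //; rewrite /Z !mem_cat !in_cons.
  by rewrite eqxx !orbT.
have Fl x : x != 0 -> x ^+ l.-1 = 1 :> 'F_l.
  move=> x0; apply: (mulfI x0); rewrite -exprS mulr1 prednK ?prime_gt0 //.
  by rewrite -[RHS]expf_card card_Fp.
(* If the residue of [zeta] had order k < n, then zeta^k - 1, a unit by the choice of [Z], would
   reduce to 0. *)
have nl : (n %| l.-1)%N.
  have [k vk kn] := prim_order_exists n0 v1.
  suff <- : k = n by rewrite (prim_order_dvd vk) Fl.
  have k0 := prim_order_gt0 vk; have := dvdn_leq n0 kn.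
  rewrite leq_eqVlt => /predU1P[//|{}kn].
  have zk : zeta ^+ k - 1 != 0.
    rewrite subr_eq0 -(prim_order_dvd zetaP); apply: contraTN kn.
    by move/dvdn_leq => /(_ k0); rewrite -leqNgt.
  have zkZ : (zeta ^+ k - 1)^-1 \in Z.
    rewrite /Z !mem_cat !in_cons -(prednK k0).
    rewrite (map_f (fun i => (zeta ^+ i.+1 - 1)^-1)) ?orbT // mem_iota.
    by move: k0 kn; clear; lia.
  have := redV _ _ zk zkZ (redB _ _ 1 (redXn _ _ k zv)).
  by rewrite (prim_expr_order vk) mulr1z subrr eqxx.
have [g gP] : exists g : 'F_l, l.-1.-primitive_root g.
  have /hasP[g _ gP] : has l.-1.-primitive_root [seq x <- enum 'F_l | x != 0].
    apply: has_prim_root.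
    - by rewrite -ltnS prednK ?prime_gt1 ?prime_gt0.
    - apply/allP => x; rewrite mem_filter => /andP[x0 _].
      by apply/unity_rootP/Fl.
    - by rewrite filter_uniq ?enum_uniq.
    - rewrite -[X in (X.-1 <= _)%N](card_Fp pl) -(cardC1 0) cardE.
      apply/eq_leq; congr size; rewrite [LHS]/enum_mem -enumT.
      exact: eq_filter.
  by exists g.
have g0 := prim_root_neq0 gP.
pose pr := \prod_(s : 'AEnd(L) | s != 1%g) ((c 1%g)%:~R - (c s)%:~R) : 'F_l.
have pr0 : pr != 0.
  apply/prodf_neq0 => s s1.
  apply: (redV (theta - s theta)).
  - by rewrite subr_eq0 eq_sym; apply: contra_neq s1 => /fixtheta.
  - by rewrite !mem_cat codom_f orbT.
  - have := cP 1%g; rewrite /= id_lfunE => th1.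
    apply: redD => //; rewrite -mulN1r -[X in red _ X]mulN1r; apply: redM => //.
    exact: (redi (-1)).
pose a : int := nat_of_ord ((g - 1) / pr).
have aE : a%:~R = (g - 1) / pr :> 'F_l by rewrite -pmulrn natr_Zp.
(* For [t != 1] the factor of [t xi] with s = t reduces to 0, which leaves 1; for [t = 1] the
   product reduces to [pr], and [a] is chosen to give [g]. *)
pose xi := 1 + a%:~R * \prod_(s : 'AEnd(L) | s != 1%g) (theta - (c s)%:~R).
have redxi (t : 'AEnd(L)) : red (t xi) (if t == 1%g then g else 1).
  have -> : t xi = 1 + a%:~R * \prod_(s : 'AEnd(L) | s != 1%g) (t theta - (c s)%:~R).
    rewrite /xi rmorphD rmorph1 rmorphM rmorph_int rmorph_prod; congr (_ + _ * _).
    by apply: eq_bigr => s _; rewrite rmorphB rmorph_int.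
  have -> : (if t == 1%g then g else 1) = 1 + a%:~R *
      \prod_(s : 'AEnd(L) | s != 1%g) ((c t)%:~R - (c s)%:~R) :> 'F_l.
    case: eqP => [->|/eqP t1]; last by rewrite (bigD1 t) //= subrr mul0r mulr0 addr0.
    by rewrite aE -/pr divfK // addrC subrK.
  apply: redD => //; apply: redM => //; apply: redP => s _; exact: redB.
exists xi.
  apply: contraNneq g0 => xi0; apply/eqP/(redf 0); last exact: (redi 0).
  by rewrite -{1}(rmorph0 (1%g : 'AEnd(L))) -xi0; have := redxi 1%g; rewrite eqxx.
move=> p y pp pn; apply/eqP => yt.
have redt : red (\prod_(s : 'AEnd(L)) s xi ^+ m s) (g ^+ m 1%g).
  rewrite (_ : g ^+ _ = \prod_(s : 'AEnd(L)) (if s == 1%g then g else 1) ^+ m s).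
    by apply: redP => s _; apply: redXn.
  by rewrite (bigD1 1%g) //= eqxx big1 ?mulr1 // => s /negPf->; rewrite expr1n.
have [] := redX p y _ _ (prime_gt0 pp) redt _ (esym yt); first by rewrite expf_neq0.
move=> w wp.
have [i wi] : exists i, w = g ^+ i.
  have w0 : w != 0.
    apply: contraTneq (expf_neq0 (m 1%g) g0) => w0.
    by rewrite -wp w0 expr0n gtn_eqF ?prime_gt0 ?eqxx.
  by have [i] := prim_rootP gP (Fl _ w0); exists i.
have : (m 1%g == 1 %[mod n]) by rewrite -(eq_prim_root_expr zetaP) m1.
move: wp; rewrite wi -exprM => /eqP; rewrite (eq_prim_root_expr gP).
move=> /eqP/(congr1 (modn^~ p)); rewrite !modn_dvdm ?(dvdn_trans pn) //.
rewrite modnMl => mp /eqP/(congr1 (modn^~ p)); rewrite !modn_dvdm // -mp.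
by rewrite modn_small ?prime_gt1.
Qed.

(** * Automorphisms of algC and number fields *)

Local Notation autC := {rmorphism algC -> algC}.

(** The splitting field of the product of the rational minimal polynomials of the members of [s]. *)
Lemma normal_num_field (s : seq algC) :
  exists (L : splittingFieldType rat) (LC : {rmorphism L -> algC}),
    forall x, x \in s -> exists y, LC y = x.
Proof.
have [pQ [pQm pQs]] : exists pQ : {poly rat}, pQ \is monic /\
    forall x, x \in s -> root (map_poly ratr pQ : {poly algC}) x.
  elim: s => [|x s [p [pm ps]]]; first by exists 1; rewrite monic1.
  have [q [_ qm] qP] := minCpolyP x; exists (q * p); split; first by rewrite monicMl.
  move=> y; rewrite inE rmorphM rootM => /predU1P[->|/ps->]; last by rewrite orbT.
  by rewrite qP dvdpp.
have [r Dr] := closed_field_poly_normal (map_poly ratr pQ : {poly algC}).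
rewrite lead_coef_map (monicP pQm) rmorph1 scale1r in Dr.
have [Qs [QsC [s1 s1r gen]]] := num_field_exists r.
have ax : splitting_field_axiom Qs.
  exists (map_poly (in_alg Qs) pQ).
    by apply/polyOverP => i; rewrite coef_map memvZ ?mem1v.
  exists s1 => //; rewrite (_ : map_poly _ _ = \prod_(z <- s1) ('X - z%:P)) ?eqpxx //.
  apply: (map_poly_inj QsC); rewrite -map_poly_comp rmorph_prod.
  under [RHS]eq_bigr do rewrite /= map_polyXsubC.
  rewrite -(big_map QsC xpredT (fun z => 'X - z%:P)) s1r -Dr.
  by apply: eq_map_poly => c /=; rewrite rmorphZ_num rmorph1 mulr1.
pose L : splittingFieldType rat :=
  HB.pack_for (splittingFieldType rat) Qs (FieldExt_isSplittingField.Build rat Qs ax).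
exists L, QsC => x /pQs; rewrite Dr root_prod_XsubC -s1r => /mapP[y _ ->].
by exists y.
Qed.

Lemma extend_aut (L : splittingFieldType rat) (LC : {rmorphism L -> algC})
  (g : 'AEnd(L)) : exists nu : autC, forall x, nu (LC x) = LC (g x).
Proof.
by have [nu nuE] := extend_algC_subfield_aut LC g; exists nu => x; rewrite nuE.
Qed.

(** Galois theory at a finite level: in a normal [L] containing [x] and [K], each element of
    Gal(L/K) extends to [algC] and hence fixes [x]. *)
Lemma num_field_fixed (K : fieldExtType rat) (KC : {rmorphism K -> algC}) (x : algC) :
  (forall nu : autC, (forall y, nu (KC y) = KC y) -> nu x = x) ->
  exists y, KC y = x.
Proof.
move=> fixx.
have [L [LC LCs]] := normal_num_field (x :: map KC (vbasis {:K})).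
have [x1 x1E] := LCs x (mem_head _ _).
have inLP y : {z | LC z == KC y}.
  apply: sigW; rewrite (coord_vbasis (memvf y)).
  have /fin_all_exists[z zE] (i : 'I_(\dim {:K})) : exists z, LC z = KC (vbasis {:K})`_i.
    by apply: LCs; rewrite inE map_f ?orbT // mem_nth // size_tuple.
  exists (\sum_i coord (vbasis {:K}) i y *: z i).
  by rewrite !rmorph_sum; apply/eqP/eq_bigr => i _; rewrite !rmorphZ_num zE.
pose inL y := sval (inLP y).
have inLE y : LC (inL y) = KC y by apply/eqP/(svalP (inLP y)).
have inLD : zmod_morphism inL.
  by move=> y z; apply: (fmorph_inj LC); rewrite rmorphB !inLE rmorphB.
have inLM : monoid_morphism inL.
  by split=> [|y z]; apply: (fmorph_inj LC); rewrite ?rmorphM !inLE ?rmorph1 ?rmorphM.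
have inLZ : scalable inL.
  by move=> a y; apply: (fmorph_inj LC); rewrite rmorphZ_num !inLE rmorphZ_num.
pose inLr : {lrmorphism K -> L} := HB.pack inL
  (GRing.isZmodMorphism.Build _ _ inL inLD) (GRing.isMonoidMorphism.Build _ _ inL inLM)
  (GRing.isScalable.Build _ _ _ _ inL inLZ).
pose f := linfun_ahom inLr.
pose E : {subfield L} := (f @: {:K})%AS.
have memE z : reflect (exists y, z = inL y) (z \in E).
  apply: (iffP memv_imgP) => [[y _ ->]|[y ->]]; exists y; rewrite ?memvf //.
    by rewrite lfunE.
  by rewrite lfunE.
have galE : galois E {:L}.
  apply/and3P; split; rewrite ?subvf ?normalFieldf //.
  by apply/separableP => z _; apply: pcharf0_separable => p; rewrite pchar_lalg pchar_num.
have /memE[y yE] : x1 \in E.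
  rewrite -(galois_fixedField galE); apply/fixedFieldP; first exact: memvf.
  move=> g gE; have [nu nuE] := extend_algC_subfield_aut LC g.
  apply: (fmorph_inj LC); rewrite nuE x1E fixx // => y.
  have yE : inL y \in E by apply/memE; exists y.
  rewrite -inLE -nuE; congr (LC _); exact: (fixed_gal (subvf E) gE yE).
by exists y; rewrite -inLE -yE.
Qed.

Definition aut_comp (mu nu : autC) : autC := mu \o nu.
Definition aut_id : autC := idfun.
Definition aut_iter (k : nat) (s : autC) : autC := iter k (aut_comp s) aut_id.

Lemma aut_iterE k (s : autC) x : aut_iter k s x = iter k s x.
Proof. by elim: k => //= k ->. Qed.

Lemma fix_basis (K : fieldExtType rat) (KC : {rmorphism K -> algC}) (nu : autC) :
  (forall x, x \in map KC (vbasis {:K}) -> nu x = x) -> forall x, nu (KC x) = KC x.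
Proof.
move=> nub x; rewrite (coord_vbasis (memvf x)) !rmorph_sum.
apply: eq_bigr => i _; rewrite rmorphZ_num rmorphM fmorph_rat nub ?map_f //.
by rewrite mem_nth // size_tuple.
Qed.

Section Restriction.
Variables (L : splittingFieldType rat) (LC : {rmorphism L -> algC}).
Implicit Types (mu nu : autC).

Definition restr (nu : autC) : 'AEnd(L) :=
  linfun_ahom (sval (restrict_aut_to_normal_num_field LC nu)).

Lemma restrE nu x : nu (LC x) = LC (restr nu x).
Proof.
by rewrite /restr /= lfunE /= (svalP (restrict_aut_to_normal_num_field LC nu)).
Qed.

Lemma restr_eq nu (g : 'AEnd(L)) : (forall x, nu (LC x) = LC (g x)) -> restr nu = g.
Proof.
move=> nug; apply/val_inj/lfunP => x; apply: (fmorph_inj LC).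
by rewrite -nug restrE.
Qed.

Lemma AEndM (f g : 'AEnd(L)) x : (f * g)%g x = g (f x).
Proof. by rewrite /= lfunE. Qed.

Lemma AEnd1 x : (1%g : 'AEnd(L)) x = x.
Proof. by rewrite /= id_lfunE. Qed.

(** Products in ['AEnd(L)] apply the left factor first, [aut_comp] the right one; hence the
    reversal. *)
Lemma restrM mu nu : restr (aut_comp mu nu) = (restr nu * restr mu)%g.
Proof. by apply: restr_eq => x; rewrite AEndM -!restrE. Qed.

Lemma restr1 nu : restr nu = 1%g <-> forall x, nu (LC x) = LC x.
Proof.
split=> [nu1 x|nu1]; first by rewrite restrE nu1 AEnd1.
by apply: restr_eq => x; rewrite AEnd1.
Qed.

(** If the sums vanish at all powers of [theta], they vanish with any polynomial in the conjugates
    [c t] as coefficient; one that is zero at every [c t] except [c h] isolates [y h]. *)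
Lemma character_independence (H : {set 'AEnd(L)}) (y : 'AEnd(L) -> algC) h :
  h \in H -> y h != 0 -> exists x, \sum_(t in H) LC (t x) * y t != 0.
Proof.
have [theta thetaI] := AEnd_separating LC => hH yh.
pose c (t : 'AEnd(L)) : algC := LC (t theta).
have cinj : injective c by move=> s t /(fmorph_inj LC)/thetaI.
pose q := \prod_(t in H | t != h) ('X - (c t)%:P).
have [[i qi]|none] := classic (exists i, \sum_(t in H) c t ^+ i * y t != 0).
  exists (theta ^+ i); apply: contra_neq qi => qi; rewrite -[RHS]qi.
  by apply: eq_bigr => t _; rewrite !rmorphXn.
have : \sum_(t in H) q.[c t] * y t = 0.
  under eq_bigr do rewrite horner_coef mulr_suml.
  rewrite exchange_big big1 //= => i _.
  under eq_bigr do rewrite -mulrA.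
  rewrite -mulr_sumr (_ : \sum_(t in H) _ = 0) ?mulr0 //.
  by apply: NNPP => /eqP ne; apply: none; exists i.
rewrite (bigD1 h) //= big1 ?addr0 => [/eqP|t /andP[tH th]].
  rewrite mulf_eq0 (negPf yh) orbF horner_prod => /eqP/eqP/prodf_eq0[t /andP[_ th]].
  by rewrite !hornerE subr_eq0 => /eqP/cinj e; rewrite e eqxx in th.
rewrite horner_prod (bigD1 t) ?tH //= !hornerE subrr !mul0r //.
Qed.

End Restriction.

Lemma modn_sum (I : finType) (n : nat) (a b : I -> nat) :
  (forall i, a i = b i %[mod n]) -> \sum_i a i = \sum_i b i %[mod n].
Proof.
move=> ab; apply: (big_ind2 (fun x y => x = y %[mod n])) => // x x' y y' xx yy.
by rewrite -modnDm xx yy modnDm.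
Qed.

(** * Corestriction of a Kummer character *)

Section KummerConjugates.
Variables (L : splittingFieldType rat) (LC : {rmorphism L -> algC}).
Variables (n : nat) (zeta : L) (zetaP : n.-primitive_root zeta).
Variables (xi : L) (xi0 : xi != 0).
Implicit Types (mu nu : autC) (s t g h : 'AEnd(L)).
Local Notation res := (restr LC).
Let n0 : (0 < n)%N := prim_order_gt0 zetaP.

Definition croot s : algC := n.-root (LC (s xi)).

Lemma crootK s : croot s ^+ n = LC (s xi).
Proof. exact: rootCK. Qed.

Lemma croot_neq0 s : croot s != 0.
Proof.
apply: contraNneq xi0 => c0; have := crootK s.
by rewrite c0 expr0n gtn_eqF // => /esym/eqP; rewrite !fmorph_eq0.
Qed.

(* The junk value n of [find] is never attained, by [aut_croot] below. *)
Definition kummer_exp s nu : nat :=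
  find (fun i => nu (croot s) == LC ((s * res nu)%g zeta) ^+ i * croot (s * res nu)%g)
    (iota 0 n).

Lemma conj_primitive s : n.-primitive_root (LC (s zeta)).
Proof. by rewrite !fmorph_primitive_root. Qed.

Lemma aut_croot s nu : nu (croot s) =
  LC ((s * res nu)%g zeta) ^+ kummer_exp s nu * croot (s * res nu)%g.
Proof.
pose P i := nu (croot s) == LC ((s * res nu)%g zeta) ^+ i * croot (s * res nu)%g.
have hasP : has P (iota 0 n).
  have := prim_rootP (conj_primitive (s * res nu)%g) (x := nu (croot s) / croot (s * res nu)%g).
  case=> [|i Hi].
    rewrite expr_div_n crootK -rmorphXn crootK restrE AEndM divff //.
    by rewrite !fmorph_eq0.
  apply/hasP; exists (val i); first by rewrite mem_iota /=.
  by rewrite /P /= -Hi divfK ?croot_neq0.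
apply/eqP; have := nth_find 0 hasP; rewrite nth_iota //.
by rewrite -[X in (_ < X)%N](size_iota 0) -has_find.
Qed.

Lemma kummer_exp_eq s nu i :
  nu (croot s) = LC ((s * res nu)%g zeta) ^+ i * croot (s * res nu)%g ->
  kummer_exp s nu = i %[mod n].
Proof.
rewrite aut_croot => /(mulIf (croot_neq0 _))/eqP.
by rewrite (eq_prim_root_expr (conj_primitive _)) => /eqP.
Qed.

(* Modulo n, this is the corestriction to Q (the composite with the transfer) of
   the Kummer character of xi. *)
Definition coresc nu : nat := \sum_s kummer_exp s nu.

(** Measured against conjugates of [zeta], the exponents satisfy k(s, mu nu) = k(s, nu) + k(s nu,
    mu) modulo [n], and translation by [res nu] permutes the index [s]. *)
Lemma corescM mu nu : coresc (aut_comp mu nu) = (coresc mu + coresc nu)%N %[mod n].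
Proof.
rewrite /coresc [in RHS](reindex_inj (mulIg (res nu))) -big_split.
apply: modn_sum => s; apply: kummer_exp_eq.
rewrite restrM mulgA; transitivity (mu (nu (croot s))) => //.
by rewrite aut_croot rmorphM rmorphXn restrE -AEndM aut_croot mulrA -exprD addnC.
Qed.

Lemma coresc_fix nu : (forall x, nu (LC x) = LC x) ->
  (forall s, nu (croot s) = croot s) -> coresc nu = 0 %[mod n].
Proof.
move=> /restr1 nu1 nus.
suff : coresc nu = (\sum_(s : 'AEnd(L)) 0)%N %[mod n] by rewrite big1_eq.
by apply: modn_sum => s; apply: kummer_exp_eq; rewrite nu1 mulg1 mul1r.
Qed.

Lemma coresc_iter k nu : coresc (aut_iter k nu) = (k * coresc nu)%N %[mod n].
Proof.
elim: k => [|k IH]; first exact: coresc_fix.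
by rewrite [aut_iter _ _]/(aut_comp nu (aut_iter k nu)) corescM -modnDmr IH modnDmr mulSn.
Qed.

Section Surjectivity.
Variable m : 'AEnd(L) -> nat.
Hypothesis mP : forall s, s zeta ^+ m s = zeta.
Hypothesis nonpow : forall p y, prime p -> (p %| n)%N ->
  \prod_(s : 'AEnd(L)) s xi ^+ m s != y ^+ p.

(** By the choice of [m], an automorphism [nu] over [L] multiplies [w] by zeta^(coresc nu). If [p]
    always divided this exponent, w^(n/p) would lie in [L], and its [p]-th power is the product
    assumed not to be one. *)
Lemma coresc_prime p : prime p -> (p %| n)%N ->
  exists2 nu : autC, forall x, nu (LC x) = LC x & ~~ (p %| coresc nu)%N.
Proof.
move=> pp pn; apply: NNPP => none.
have allp nu : (forall x, nu (LC x) = LC x) -> (p %| coresc nu)%N.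
  by move=> nu1; apply: contra_notT none => ?; exists nu.
pose w := \prod_s croot s ^+ m s.
have wn : w ^+ n = LC (\prod_(s : 'AEnd(L)) s xi ^+ m s).
  rewrite -prodrXl rmorph_prod; apply: eq_bigr => s _.
  by rewrite -exprM mulnC exprM crootK rmorphXn.
have [y yw] : exists y, LC y = w ^+ (n %/ p).
  apply: num_field_fixed => nu nu1; rewrite rmorphXn.
  have -> : nu w = LC zeta ^+ coresc nu * w.
    rewrite rmorph_prod -prodrXr -big_split; apply: eq_bigr => s _ /=.
    rewrite rmorphXn aut_croot (restr1 LC nu).2 // mulg1 exprMn.
    by rewrite -exprM mulnC exprM -[in RHS](mP s) rmorphXn.
  rewrite exprMn -exprM (_ : LC zeta ^+ _ = 1) ?mul1r //.
  have /dvdnP[q ->] := allp nu nu1; rewrite -mulnA [(p * _)%N]mulnC divnK //.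
  by rewrite mulnC exprM -rmorphXn (prim_expr_order zetaP) rmorph1 expr1n.
case/eqP: (nonpow y pp pn); apply: (fmorph_inj LC).
by rewrite -wn rmorphXn yw -exprM divnK.
Qed.

(** A value prime to [n] is built by treating the primes of [n] in turn; a Bezout multiple of it is
    1 modulo [n]. *)
Lemma coresc_onto :
  exists2 nu : autC, forall x, nu (LC x) = LC x & coresc nu = 1 %[mod n].
Proof.
suff [nu nu1 cop] : exists2 nu : autC, forall x, nu (LC x) = LC x & coprime (coresc nu) n.
  have [r0|r0] := posnP (coresc nu).
    exists nu => //; move: cop; rewrite r0 /coprime gcd0n => /eqP->.
    by rewrite !modn1.
  have /(coprimeP _ r0)[[u v] /= uv] := cop.
  exists (aut_iter u nu); last first.
    have {}uv : (u * coresc nu = v * n + 1)%N.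
      by move: uv; move: (u * _)%N (v * n)%N; lia.
    by rewrite coresc_iter uv modnMDl.
  by move=> x; rewrite aut_iterE; elim: u {uv} => //= u ->.
suff H (ps : seq nat) : {subset ps <= primes n} -> uniq ps ->
    exists2 nu : autC, forall x, nu (LC x) = LC x &
      forall p, p \in ps -> ~~ (p %| coresc nu)%N.
  have [nu nu1 nup] := H (primes n) (fun _ => id) (primes_uniq n).
  exists nu => //; rewrite coprime_sym.
  have [r0|r0] := posnP (coresc nu).
    have [|n1] := ltnP 1 n; last first.
      by rewrite (_ : n = 1%N) ?coprime1n //; apply/eqP; rewrite eqn_leq n1.
    move=> n1; have := nup (pdiv n); rewrite r0 dvdn0 mem_primes pdiv_prime //.
    by rewrite n0 pdiv_dvd => /(_ isT).
  rewrite coprime_sym coprime_has_primes //; apply/hasPn => p pn /=.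
  by rewrite mem_primes r0 (negPf (nup p pn)) !andbF.
elim: ps => [|p ps IH] sub; first by exists aut_id.
move=> /andP[pps ups].
have subps q : q \in ps -> q \in primes n by move=> qs; rewrite sub // inE qs orbT.
have [nu nu1 nup] := IH subps ups.
have pq : {in ps, forall q, prime q}.
  by move=> q qs; move: (subps q qs); rewrite mem_primes => /andP[].
have [pp pn] : prime p /\ (p %| n)%N.
  by move: (sub p (mem_head _ _)); rewrite mem_primes => /and3P[].
have [pnu|pnu] := boolP (p %| coresc nu)%N; last first.
  by exists nu => // q; rewrite inE => /predU1P[->|/nup].
have [sp sp1 spp] := coresc_prime pp pn.
(* Iterating [sp] as many times as the product of the earlier primes changes the value modulo [p]
   but not modulo those primes. *)
exists (aut_comp nu (aut_iter (\prod_(q <- ps) q)%N sp)).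
  move=> x /=; rewrite aut_iterE -[RHS]nu1; congr (nu _).
  by elim: (\prod_(q <- ps) q)%N => //= i ->.
have dvdsum q : (q %| n)%N ->
    (q %| coresc (aut_comp nu (aut_iter (\prod_(q <- ps) q)%N sp)))%N =
    (q %| coresc nu + (\prod_(q <- ps) q) * coresc sp)%N.
  move=> qn; rewrite /dvdn -(modn_dvdm _ qn) corescM -modnDmr coresc_iter modnDmr.
  by rewrite modn_dvdm.
move=> q; rewrite inE => /predU1P[->|qps].
  rewrite dvdsum // dvdn_addr // Euclid_dvdM // negb_or spp andbT.
  rewrite Euclid_dvd_prod // big_has; apply/hasPn => q' q's.
  by rewrite (dvdn_prime2 pp (pq _ q's)); apply: contra pps => /eqP->.
rewrite dvdsum; first by rewrite dvdn_addl ?nup // (big_rem q) //= -mulnA dvdn_mulr.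
by move: (subps q qps); rewrite mem_primes => /and3P[].
Qed.

End Surjectivity.

Section Norms.
Variables (H : {group 'AEnd(L)}) (a : L) (a0 : a != 0).
Hypothesis fixa : forall h, h \in H -> h (a ^+ n) = a ^+ n.

Lemma fix_pow h : h \in H -> h a ^+ n = a ^+ n.
Proof. by move=> hH; rewrite -[RHS](fixa hH) rmorphXn. Qed.

(* Only H fixes a ^+ n, so s a / a need not be a root of unity; replacing s by its
   component along the coset s H repairs this, compatibly with H. *)
Definition coset_part (s : 'AEnd(L)) : 'AEnd(L) := ((repr (s *: H))^-1 * s)%g.

Lemma coset_part_in s : coset_part s \in H.
Proof.
have /lcosetP[h hH hE] := mem_repr s (lcoset_refl H s).
by rewrite /coset_part hE invMg mulgKV groupV.
Qed.

Lemma coset_partM s t : t \in H -> coset_part (s * t)%g = (coset_part s * t)%g.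
Proof. by move=> tH; rewrite /coset_part lcosetM lcoset_id // mulgA. Qed.

Lemma twist_exists : exists e : 'AEnd(L) -> nat,
  forall s, s zeta ^+ e s = coset_part s a / a.
Proof.
have /fin_all_exists : forall s, exists i, s zeta ^+ i = coset_part s a / a.
  move=> s; have szP : n.-primitive_root (s zeta) by rewrite fmorph_primitive_root.
  have [|i ->] := prim_rootP szP (x := coset_part s a / a); last by exists i.
  rewrite expr_div_n fix_pow ?coset_part_in // divff //.
  by rewrite expf_neq0.
by case=> e eP; exists e.
Qed.

(* For x in L and t in H let T x be the resolvent [\sum_(t in H) t x * y t]; here
   y is such that an automorphism nu over H maps T x to u nu * T (x / a ^+ coresc nu),
   with u nu independent of x.  Then b = T x / T (x / a) has norm
   T x / T (x / a ^+ n) = a ^+ n, by telescoping. *)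
Lemma coresc_norm (s : autC) : (forall x, s (LC x) = LC x) -> coresc s = 1 %[mod n] ->
  exists b : algC,
    (forall nu, res nu \in H -> (n %| coresc nu)%N -> nu b = b) /\
    \prod_(j < n) iter j s b = LC (a ^+ n).
Proof.
move=> s1 sR; have [e eP] := twist_exists.
(* The exponents [e] turn the roots of unity introduced by [nu] into quotients of conjugates of [a]:
   the numerators multiply to [u nu], independent of [t], and the denominators to a power with
   exponent [coresc nu]. *)
pose y t := \prod_s croot (s * t)%g ^+ e s.
have y0 t : y t != 0 by apply/prodf_neq0 => u _; rewrite expf_neq0 ?croot_neq0.
pose u nu := \prod_s LC (res nu (coset_part s a)) ^+ kummer_exp s nu.
have u0 nu : u nu != 0 by apply/prodf_neq0 => v _; rewrite expf_neq0 // !fmorph_eq0.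
have nuy nu t : res nu \in H -> t \in H ->
    nu (y t) = u nu / LC ((t * res nu)%g a) ^+ coresc nu * y (t * res nu)%g.
  move=> nuH tH.
  have key v : LC ((v * t * res nu)%g zeta) ^+ e v =
      LC (res nu (coset_part (v * t)%g a)) / LC ((t * res nu)%g a).
    rewrite coset_partM //.
    transitivity (LC ((t * res nu)%g (v zeta ^+ e v))).
      by rewrite !AEndM !rmorphXn.
    have cpM : (t * res nu)%g (coset_part v a) = res nu ((coset_part v * t)%g a).
      by rewrite !AEndM.
    by rewrite eP !fmorph_div -cpM.
  rewrite rmorph_prod /u /coresc -prodrXr -prodf_div.
  rewrite [in RHS](reindex_inj (mulIg t)) -big_split; apply: eq_bigr => v _ /=.
  rewrite rmorphXn aut_croot exprMn mulgA; congr (_ * _).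
  by rewrite -exprM mulnC exprM key expr_div_n.
pose T x := \sum_(t in H) LC (t x) * y t.
have nuT nu x : res nu \in H -> nu (T x) = u nu * T (x / a ^+ coresc nu).
  move=> nuH; rewrite rmorph_sum mulr_sumr [RHS](reindex_inj (mulIg (res nu))).
  apply: eq_big => [t|t tH]; first by rewrite groupMr.
  by rewrite rmorphM nuy // restrE -AEndM !fmorph_div !rmorphXn; ring.
have [x Tx0] := character_independence LC (group1 H) (y0 1%g).
pose t j := T (x / a ^+ j).
have nut nu j : res nu \in H -> nu (t j) = u nu * t (coresc nu + j)%N.
  by move=> nuH; rewrite nuT // -mulrA -invfM -exprD addnC.
pose c := LC (a ^+ n).
have c0 : c != 0 by rewrite fmorph_eq0 expf_neq0.
have tn j q : t (q * n + j)%N = t j / c ^+ q.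
  rewrite /t /T mulr_suml; apply: eq_bigr => v vH.
  have -> : v (x / a ^+ (q * n + j)) = v (x / a ^+ j) / (a ^+ n) ^+ q.
    rewrite !fmorph_div !rmorphXn exprD mulnC exprM fix_pow //.
    by rewrite invfM mulrA mulrAC.
  by rewrite fmorph_div rmorphXn mulrAC.
(* Since [H] fixes [a ^+ n], a shift of the index by [n] scales all the [t j] by one constant. *)
have tmod i k : i = k %[mod n] -> exists2 d, d != 0 & forall j, t (i + j)%N = d * t (k + j)%N.
  move=> ik; exists (c ^+ (k %/ n) / c ^+ (i %/ n)).
    by rewrite mulf_neq0 ?invr_eq0 ?expf_neq0.
  have te (h l : nat) : t (h + l)%N = t (h %% n + l)%N / c ^+ (h %/ n).
    by rewrite {1}(divn_eq h n) -addnA tn.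
  move=> l; rewrite (te i) (te k) ik.
  by field; rewrite !expf_neq0.
have res_s : res s = 1%g by apply/restr1.
have [d d0 dt] := tmod _ _ sR.
have st j : s (t j) = u s * d * t j.+1 by rewrite nut ?res_s // dt mulrA.
have t0 j : t j != 0.
  elim: j => [|j IH]; first by rewrite /t expr0 divr1.
  by rewrite -(fmorph_eq0 s) st !mulf_eq0 negb_or in IH; case/andP: IH.
exists (t 0 / t 1); split=> [nu nuH nR|].
  have nR0 : coresc nu = 0 %[mod n] by apply/eqP; rewrite mod0n.
  have [d' d'0 d't] := tmod _ _ nR0.
  rewrite fmorph_div !nut // !d't !add0n.
  by field; rewrite u0 d'0 t0.
have it j : iter j s (t 0 / t 1) = t j / t j.+1.
  elim: j => //= j ->; rewrite fmorph_div !st.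
  by field; rewrite u0 d0 t0.
under eq_bigr do rewrite it.
have -> : forall k, \prod_(j < k) (t j / t j.+1) = t 0 / t k.
  elim=> [|k IH]; first by rewrite big_ord0 divff.
  by rewrite big_ord_recr /= IH mulrA divfK.
have := tn 0%N 1%N; rewrite mul1n addn0 expr1 => ->.
by field; rewrite c0 t0.
Qed.

End Norms.
End KummerConjugates.

(** [R] is [coresc] for one well chosen [xi], so the same character serves for all [H] and [a]. The
    finite list [S] expresses that its kernel is open. *)
Lemma cyclic_character (L : splittingFieldType rat) (LC : {rmorphism L -> algC})
    (n : nat) (zeta : L) : n.-primitive_root zeta ->
  exists (R : autC -> nat) (S : seq algC) (s : autC),
  [/\ forall mu nu, R (aut_comp mu nu) = (R mu + R nu)%N %[mod n],
      forall nu : autC, (forall x, x \in S -> nu x = x) -> R nu = 0 %[mod n],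
      forall x, s (LC x) = LC x, R s = 1 %[mod n]
    & forall (H : {group 'AEnd(L)}) (a : L), a != 0 ->
        (forall h, h \in H -> h (a ^+ n) = a ^+ n) ->
        exists b : algC,
          (forall nu : autC, restr LC nu \in H -> (n %| R nu)%N -> nu b = b) /\
          \prod_(j < n) iter j s b = LC (a ^+ n)].
Proof.
move=> zetaP.
have /fin_all_exists[m mP] (s : 'AEnd(L)) : exists i, s zeta ^+ i = zeta.
  have szP : n.-primitive_root (s zeta) by rewrite fmorph_primitive_root.
  have [i Hi] := prim_rootP szP (prim_expr_order zetaP).
  by exists i; rewrite -Hi.
have [xi xi0 nonpow] : exists2 xi : L, xi != 0 & forall p y, prime p -> (p %| n)%N ->
    \prod_(s : 'AEnd(L)) s xi ^+ m s != y ^+ p.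
  by apply: (non_power_exists LC zetaP); have := mP 1%g; rewrite AEnd1.
have [s s1 sR] := coresc_onto LC zetaP xi0 mP nonpow.
exists (coresc LC n zeta xi), (map LC (vbasis {:L}) ++ codom (croot LC n xi)), s.
split=> //.
- exact: corescM.
- move=> nu nuS; apply: coresc_fix => // [x|t].
    by apply: fix_basis x => y yb; apply: nuS; rewrite mem_cat yb.
  by apply: nuS; rewrite mem_cat codom_f orbT.
by move=> H a a0 fixa; apply: coresc_norm.
Qed.

(** * The inductive step *)

(** A finite list stands for the field it generates, and [fixes] for the corresponding open subgroup
    of automorphisms. *)
Definition fixes (s : seq algC) (nu : autC) : bool := all (fun x => nu x == x) s.

Lemma fixesP s (nu : autC) : reflect (forall x, x \in s -> nu x = x) (fixes s nu).
Proof. by apply: (iffP allP) => h x /h /eqP. Qed.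

Definition inv_aut (nu : autC) : autC := algC_invaut nu.

Section FiniteLevel.
Variables (gT : finGroupType) (f : autC -> gT) (S : seq algC).
Hypothesis fM : forall mu nu, f (aut_comp mu nu) = (f mu * f nu)%g.
Hypothesis fS : forall nu, fixes S nu -> f nu = 1%g.

Lemma aut_morphV (nu : autC) : f (inv_aut nu) = (f nu)^-1%g.
Proof.
apply/eqP; rewrite eq_sym eq_invg_mul -fM; apply/eqP/fS/fixesP => x _.
exact: algC_invautK.
Qed.

Lemma fixed_ker_agree (sk : seq algC) (b : algC) (mu nu : autC) :
  (forall nu : autC, fixes sk nu -> f nu = 1%g -> nu b = b) ->
  fixes sk mu -> fixes sk nu -> f mu = f nu -> mu b = nu b.
Proof.
move=> fixb /fixesP kmu /fixesP knu fmunu.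
have fix1 : fixes sk (aut_comp (inv_aut nu) mu).
  by apply/fixesP => x xk /=; rewrite kmu // -{1}(knu x xk) algC_autK.
have := fixb _ fix1; rewrite fM aut_morphV fmunu mulVg => /(_ erefl) {2}<-.
by rewrite /= algC_invautK.
Qed.

Lemma aut_morph_agree (mu nu : autC) :
  (forall x, x \in S -> mu x = nu x) -> f mu = f nu.
Proof.
move=> munu; apply: (mulgI (f nu)^-1%g); rewrite mulVg -aut_morphV -fM; apply: fS.
by apply/fixesP => x xS /=; rewrite munu // algC_autK.
Qed.

(** Since [sk] and [S] lie in [L], both conditions depend only on the restriction to [L] and can be
    tested on any extension to [algC]. *)
Lemma level_subgroup (sk : seq algC) (L : splittingFieldType rat)
    (LC : {rmorphism L -> algC}) :
  (forall y, y \in sk -> exists z, LC z = y) ->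
  (forall y, y \in S -> exists z, LC z = y) ->
  exists H : {group 'AEnd(L)},
    forall nu : autC, (restr LC nu \in H) = fixes sk nu && (f nu == 1%g).
Proof.
move=> skL SL.
pose ext g : autC := sval (extend_algC_subfield_aut LC (g : 'AEnd(L))).
have extE g y : ext g (LC y) = LC (g y).
  by rewrite /ext -(svalP (extend_algC_subfield_aut LC g)).
pose good nu := fixes sk nu && (f nu == 1%g).
have good_agree (mu nu : autC) : (forall y, mu (LC y) = nu (LC y)) -> good mu = good nu.
  move=> munu; congr (_ && _).
    by apply: eq_in_all => y /skL[z <-]; rewrite munu.
  by rewrite (aut_morph_agree (mu := mu) (nu := nu)) // => y /SL[z <-].
have gH : group_set [set g | good (ext g)].
  apply/group_setP; split=> [|g h].
    rewrite inE (good_agree _ aut_id) => [|y]; last by rewrite extE AEnd1.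
    apply/andP; split; first by apply/fixesP.
    by apply/eqP/fS/fixesP.
  rewrite !inE => /andP[/fixesP gk /eqP fg] /andP[/fixesP hk /eqP fh].
  rewrite (good_agree _ (aut_comp (ext h) (ext g))) => [|y]; last first.
    by rewrite /= !extE AEndM.
  apply/andP; split; last by rewrite fM fg fh mulg1.
  by apply/fixesP => y yk /=; rewrite gk ?hk.
by exists (group gH) => nu; rewrite inE; apply: good_agree => y; rewrite extE restrE.
Qed.

End FiniteLevel.

(* f presents H as a quotient of the group of automorphisms fixing sk (with open
   kernel, by the fourth condition), and b i has norm a i from the field fixed by
   its kernel; the norm is computed with an arbitrary choice of lifts. *)
Definition norm_datum (sk : seq algC) (gT : finGroupType) (H : {set gT})
    (m : nat) (a : 'I_m -> algC) (f : autC -> gT) (S : seq algC) (b : 'I_m -> algC) :=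
  [/\ forall nu, f nu \in H,
      forall mu nu, f (aut_comp mu nu) = (f mu * f nu)%g,
      forall h, h \in H -> exists2 nu, fixes sk nu & f nu = h,
      forall nu, fixes S nu -> f nu = 1%g
    & forall i, [/\ b i != 0,
        forall nu : autC, fixes sk nu -> f nu = 1%g -> nu (b i) = b i
      & forall lift : gT -> autC,
          (forall h, h \in H -> fixes sk (lift h) /\ f (lift h) = h) ->
          \prod_(h in H) lift h (b i) = a i]].

(** Transitivity of norms: the new elements have norm [b i] in the cyclic layer cut out by [R], and
    [b i] has norm [a i] below it. *)
Lemma norm_datum_step sk (gT : finGroupType) (H H' : {group gT}) (x : gT) m
    (a : 'I_m -> algC) f S b :
  (H \x <[x]>)%g = H' -> abelian H' -> norm_datum sk H a f S b ->
  exists f' S' b', norm_datum sk H' a f' S' b'.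
Proof.
move=> HxH' abH' [fH fM fonto fS bP].
have [_ HxE cHx tiHx] := dprodP HxH'.
pose n := #[x]%g; have [zC zCP] := C_prim_root_exists (order_gt0 x).
have [L [LC LCs]] :=
  normal_num_field (zC :: sk ++ S ++ codom (fun i => n.-root (b i))).
have [zeta zetaE] := LCs zC (mem_head _ _).
have zetaP : n.-primitive_root zeta by rewrite -(fmorph_primitive_root LC) zetaE.
have n0 : (0 < n)%N := order_gt0 x.
have skL y : y \in sk -> exists z, LC z = y.
  by move=> yk; apply: LCs; rewrite in_cons mem_cat yk orbT.
have SL y : y \in S -> exists z, LC z = y.
  by move=> yk; apply: LCs; rewrite in_cons !mem_cat yk !orbT.
have /fin_all_exists[al alE] i : exists z, LC z = n.-root (b i).
  by apply: LCs; rewrite in_cons !mem_cat codom_f !orbT.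
have alX i : LC (al i ^+ n) = b i by rewrite rmorphXn alE rootCK.
have [R [SR [s [RM RS s1 sR normR]]]] := cyclic_character LC zetaP.
pose good (nu : autC) := fixes sk nu && (f nu == 1%g).
(* [H1] is the Galois group of [L] over the field reached so far, which contains the [b i]. *)
have [H1 resH1] : exists H1 : {group 'AEnd(L)},
    forall nu : autC, (restr LC nu \in H1) = good nu.
  exact: (level_subgroup fM fS skL SL).
have /fin_all_exists[c cP] i : exists c, c != 0 /\
   ((forall nu : autC, good nu -> (n %| R nu)%N -> nu c = c) /\
    \prod_(j < n) iter j s c = b i).
  have [b0 fixb _] := bP i.
  have al0 : al i != 0.
    by apply: contraNneq b0 => al0; rewrite -alX al0 expr0n gtn_eqF ?rmorph0.
  have [h hH|c [cfix cn]] := normR H1 (al i) al0.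
    have [nu nuE] := extend_aut LC h; rewrite -(restr_eq nuE) resH1 in hH.
    have /andP[nuk /eqP fnu] := hH.
    by apply: (fmorph_inj LC); rewrite -nuE alX fixb.
  rewrite alX in cn; exists c; split; last first.
    by split=> // nu gnu nR; apply: cfix; rewrite ?resH1.
  by apply: contraNneq b0 => c0; rewrite -cn (bigD1 (Ordinal n0)) //= c0 mul0r.
pose f' nu := (f nu * x ^+ R nu)%g.
have xR i j : i = j %[mod n] -> (x ^+ i = x ^+ j)%g.
  by move=> ij; apply/eqP; rewrite eq_expg_mod_order; apply/eqP.
have xTI h i h1 j : h \in H -> h1 \in H -> (h * x ^+ i = h1 * x ^+ j)%g ->
    h = h1 /\ (x ^+ i = x ^+ j)%g.
  move=> hH h1H e; have E : (h1^-1 * h = x ^+ j * x ^- i)%g.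
    by apply: (mulgI h1); rewrite mulKVg mulgA -e mulgK.
  have : (h1^-1 * h \in H :&: <[x]>)%g.
    by rewrite inE groupM ?groupV //= E groupM ?groupV ?mem_cycle.
  rewrite tiHx => /set1gP hh1; split; first by apply: (mulgI h1^-1%g); rewrite hh1 mulVg.
  by apply: (mulIg (x ^- i)%g); rewrite -E hh1 mulgV.
have f'M mu nu : f' (aut_comp mu nu) = (f' mu * f' nu)%g.
  rewrite /f' fM (xR _ _ (RM mu nu)) expgD !mulgA; congr (_ * _)%g; rewrite -!mulgA.
  by congr (_ * _)%g; symmetry; apply: (centsP cHx); rewrite ?mem_cycle.
(* Being trivial on [L], [s] is in the kernel of [f], while [R s] is 1; so [f' s] is [x], and [s]
   generates the new layer. *)
have /andP[sk_s /eqP f_s] : good s by rewrite -resH1 (restr1 LC s).2 ?group1.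
have f'S nu : fixes (S ++ SR) nu -> f' nu = 1%g.
  rewrite /fixes all_cat => /andP[nuS /fixesP nuSR].
  by rewrite /f' fS // mul1g (xR _ _ (RS nu nuSR)).
have f's j : f' (aut_iter j s) = (x ^+ j)%g.
  elim: j => [|j IH]; first by apply/f'S/fixesP.
  by rewrite [aut_iter _ _]/(aut_comp s (aut_iter j s)) f'M IH expgS /f' f_s mul1g (xR _ _ sR).
have sk_it j : fixes sk (aut_iter j s).
  apply/fixesP => y yk; rewrite aut_iterE.
  by elim: j => //= j ->; apply: (fixesP _ _ sk_s).
have sk_comp mu nu : fixes sk mu -> fixes sk nu -> fixes sk (aut_comp mu nu).
  by move=> /fixesP muk /fixesP nuk; apply/fixesP => y yk /=; rewrite nuk ?muk.
have fixc i (nu : autC) : fixes sk nu -> f' nu = 1%g -> nu (c i) = c i.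
  move=> nuk f'nu; have e : (f nu * x ^+ R nu = 1 * x ^+ 0)%g by rewrite mul1g.
  have [fnu xRnu] := xTI _ _ _ _ (fH nu) (group1 H) e.
  have [_ [cfix _]] := cP i.
  by apply: cfix; [rewrite /good nuk fnu eqxx | rewrite order_dvdn xRnu].
have H'E h' : reflect (exists2 h, h \in H & exists j : 'I_n, h' = (h * x ^+ j)%g) (h' \in H').
  rewrite -HxE; apply: (iffP mulsgP) => [[h _ hH /cycleP[j ->] ->]|[h hH [j ->]]].
    exists h => //; exists (Ordinal (ltn_pmod j n0)); congr (_ * _)%g.
    by apply: xR; rewrite /= modn_mod.
  by exists h (x ^+ j)%g; rewrite ?mem_cycle.
exists f', (S ++ SR), c; split=> //.
- by move=> nu; rewrite -HxE mem_mulg ?mem_cycle.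
- move=> _ /H'E[h hH [j ->]]; have [nu nuk fnu] := fonto h hH.
  (* The extra iterations of [s] cancel the contribution [R nu] of the lift of [h]. *)
  exists (aut_comp nu (aut_iter (j + (n - R nu %% n)) s)); first exact: sk_comp.
  rewrite f'M f's /f' fnu -mulgA -expgD; congr (_ * _)%g; apply: xR.
  rewrite -modnDml addnCA subnKC ?modnDr // ltnW // ltn_pmod //.
move=> i; have [c0 [_ cn]] := cP i; split=> // [nu|lift liftP]; first exact: fixc.
have [_ _ bn] := bP i.
pose hx (p : gT * 'I_n) := (p.1 * x ^+ p.2)%g.
have hxinj : {in setX H [set: 'I_n] &, injective hx}.
  move=> [h i1] [h1 j] /setXP[/= hH _] /setXP[/= h1H _] e.
  have [-> /eqP] := xTI h i1 h1 j hH h1H e.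
  rewrite eq_expg_mod_order !modn_small ?ltn_ord // => /eqP ij.
  by congr (_, _); apply: val_inj.
have H'img : H' = hx @: setX H [set: 'I_n] :> {set gT}.
  apply/setP => h'; apply/H'E/imsetP => [[h hH [j ->]]|[[h j] /setXP[hH _] ->]].
    by exists (h, j) => //; apply/setXP; rewrite inE.
  by exists h => //; exists j.
have liftH h : h \in H -> fixes sk (lift h) /\ f (lift h) = h.
  move=> hH; have /liftP[hk f'h] : h \in H'.
    by apply/H'E; exists h => //; exists (Ordinal n0); rewrite mulg1.
  split=> //; have e : (f (lift h) * x ^+ R (lift h) = h * x ^+ 0)%g by rewrite mulg1.
  by have [] := xTI _ _ _ _ (fH (lift h)) hH e.
(* The product over [H'] becomes a double product: on [c i], the lift of h x^j agrees with the lift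
   of h composed with s^j. *)
rewrite -(bn lift) // H'img big_imset //=.
rewrite (eq_bigl (fun p : gT * 'I_n => (p.1 \in H) && true)); last first.
  by move=> [h j]; rewrite !inE.
rewrite -(pair_big (mem H) xpredT (fun h j => lift (hx (h, j)) (c i))) /=.
apply: eq_bigr => h hH; rewrite -cn rmorph_prod; apply: eq_bigr => j _.
rewrite -aut_iterE -[RHS]/(aut_comp (lift h) (aut_iter j s) (c i)).
have [hk f'h] : fixes sk (lift h) /\ f' (lift h) = h.
  by apply: liftP; apply/H'E; exists h => //; exists (Ordinal n0); rewrite mulg1.
have [hxk f'hx] : fixes sk (lift (hx (h, j))) /\ f' (lift (hx (h, j))) = hx (h, j).
  by apply: liftP; apply/H'E; exists h => //; exists j.
apply: (fixed_ker_agree (S := S ++ SR) f'M f'S (fixc i)) => //; first exact: sk_comp.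
by rewrite f'M f's f'h.
Qed.

(** Induction on a decomposition of [G] into cyclic factors; for the trivial group each [a i] is its
    own norm. *)
Lemma norm_datum_exists sk (gT : finGroupType) (G : {group gT}) m (a : 'I_m -> algC) :
  abelian G -> (forall i, a i != 0) ->
  (forall i (nu : autC), fixes sk nu -> nu (a i) = a i) ->
  exists f S b, norm_datum sk G a f S b.
Proof.
move=> abG a0 fixa; have [xs + _] := abelian_structure abG.
elim: xs G abG => [|x xs IH] G abG.
  rewrite big_nil => G1; exists (fun=> 1%g), [::], a; split=> //.
  - by move=> mu nu; rewrite mulg1.
  - by move=> h; rewrite -G1 => /set1gP->; exists aut_id => //; apply/fixesP.
  move=> i; split=> // [nu nuk _|lift liftP]; first exact: fixa.
  by rewrite -G1 big_set1; apply: fixa; have [] := liftP 1%g (group1 G).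
rewrite big_cons => defG; have [[K H _ defH] _ _ _] := dprodP defG.
have sHG : H \subset G by rewrite -defH; have /dprodW <- := defG; rewrite mulG_subr.
have [f [S [b datum]]] := IH H (abelianS sHG abG) defH.
apply: (norm_datum_step (x := x) _ abG datum).
by rewrite dprodC -defH.
Qed.

(** * Embeddings into [algC] and simple extensions *)

Lemma num_field_embedding (k : fieldExtType rat) : exists iota : k -> algC,
  zmod_morphism iota /\ monoid_morphism iota.
Proof.
have sep : separable 1 {:k}.
  by apply/separableP => x _; apply: pcharf0_separable => p; rewrite pchar_lalg pchar_num.
have gen := eq_adjoin_separable_generator sep (sub1v _).
set th := separable_generator _ _ in gen.
have [q qE] : exists q : {poly rat}, minPoly 1 th = map_poly (in_alg k) q.
  have /polyOver1P[q ->] := minPolyOver 1%AS th; by exists q.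
have [z qz] : exists z : algC, root (map_poly ratr q) z.
  apply/closed_rootP; rewrite size_map_poly.
  by have := size_minPoly 1%AS th; rewrite qE size_map_poly => ->.
pose ev (p : {poly rat}) : algC := (map_poly ratr p).[z].
pose evk (p : {poly rat}) : k := (map_poly (in_alg k) p).[th].
(* Evaluation at [z] is well defined on [k] because [z] is a root of the minimal polynomial of
   [th]. *)
have evE p1 p2 : evk p1 = evk p2 -> ev p1 = ev p2.
  move=> /eqP; rewrite -subr_eq0 -hornerN -hornerD -rmorphN -rmorphD => pth.
  have : minPoly 1 th %| map_poly (in_alg k) (p1 - p2).
    by apply: minPoly_dvdp => //; apply/polyOver1P; exists (p1 - p2).
  rewrite qE dvdp_map -(dvdp_map (ratr : rat -> algC)) => /dvdpP[h hE].
  have {}hE : map_poly ratr p1 - map_poly ratr p2 = h * map_poly ratr q :> {poly algC}.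
    by rewrite -rmorphB; apply: hE.
  apply/eqP; rewrite -subr_eq0 -hornerN -hornerD hE hornerM.
  by rewrite (rootP qz) mulr0.
have pre x : {p | x == evk p}.
  apply: sigW; have : x \in <<1; th>>%VS by rewrite -gen memvf.
  by case/Fadjoin_polyP => p /polyOver1P[p' ->] ->; exists p'.
pose iota x := ev (sval (pre x)).
have iotaE p x : x = evk p -> iota x = ev p.
  by move=> xp; apply: evE; rewrite -xp; apply/esym/eqP/(svalP (pre x)).
have preE x : x = evk (sval (pre x)) by apply/eqP/(svalP (pre x)).
exists iota; split; last split.
- move=> x y; rewrite (iotaE (sval (pre x) - sval (pre y))).
    by rewrite /ev rmorphB hornerD hornerN.
  by rewrite {1}(preE x) {1}(preE y) /evk rmorphB hornerD hornerN.
- by rewrite (iotaE 1) ?/ev ?/evk ?rmorph1 ?hornerC.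
move=> x y; rewrite (iotaE (sval (pre x) * sval (pre y))).
  by rewrite /ev rmorphM hornerM.
by rewrite {1}(preE x) {1}(preE y) /evk rmorphM hornerM.
Qed.

(** Adjoining [z] as an abstract extension of [F] lets Galois groups and norms be taken over [F];
    the minimality of [r] is its irreducibility. *)
Lemma simple_extension (F E : fieldType) (iota : {rmorphism F -> E}) (z : E)
    (r : {poly F}) :
  r != 0 -> root (map_poly iota r) z ->
  (forall q, root (map_poly iota q) z -> q != 0 -> (size r <= size q)%N) ->
  exists (K : fieldExtType F) (j : {rmorphism K -> E}) (y : K),
  [/\ \dim {:K} = (size r).-1, forall a, j a%:A = iota a, j y = z
    & forall x, exists q, x = (map_poly (in_alg K) q).[y]].
Proof.
move=> r0 rz minr; have irr := (subfx_irreducibleP rz r0).1 minr.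
exists (SubFieldExtType rz irr), (@subfx_inj _ _ iota z r), (subfx_root iota z r).
split; last by move=> x; have [q ->] := subfxEroot rz r0 x; exists q.
- by rewrite dimvf.
- exact: subfx_inj_base.
- exact: subfx_inj_root.
Qed.

Section OverNumberField.
Variables (k : fieldExtType rat) (K : fieldExtType k) (j : {rmorphism K -> algC}).

Lemma ext_field_fixed (x : algC) :
  (forall nu : autC, (forall y, nu (j y) = j y) -> nu x = x) -> exists y, j y = x.
Proof. exact: (@num_field_fixed (baseFieldType K) j). Qed.

Lemma ext_field_aut (g : {rmorphism K -> K}) :
  {nu : autC | forall x, nu (j x) = j (g x)}.
Proof.
have [nu nuE] := @extend_algC_subfield_aut (baseFieldType K) j g.
by exists nu => x; rewrite nuE.
Qed.

End OverNumberField.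

(** * The extension cut out by a finite quotient *)

(** A primitive element of the field fixed by the kernel. The polynomial [P g], with roots the
    conjugates of [theta] along the coset H g, differs from [P 1] for g outside [H]; [z] is the
    value of [P 1] at an integer separating it from all of these. *)
Lemma kernel_generator (sk : seq algC) (gT : finGroupType) (f : autC -> gT)
    (S : seq algC) :
  (forall mu nu, f (aut_comp mu nu) = (f mu * f nu)%g) ->
  (forall nu, fixes S nu -> f nu = 1%g) ->
  exists z, forall nu : autC, fixes sk nu -> nu z = z <-> f nu = 1%g.
Proof.
move=> fM fS; have [L [LC LCs]] := normal_num_field (sk ++ S).
have skL y : y \in sk -> exists z, LC z = y.
  by move=> yk; apply: LCs; rewrite mem_cat yk.
have SL y : y \in S -> exists z, LC z = y.
  by move=> yk; apply: LCs; rewrite mem_cat yk orbT.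
have [H HP] := level_subgroup fM fS skL SL.
have [theta thetaI] := AEnd_separating LC.
pose P (g : 'AEnd(L)) := \prod_(h in H) ('X - ((h * g)%g theta)%:P).
have PE g c : (P g).[c] = \prod_(h in H) (c - (h * g)%g theta).
  by rewrite horner_prod; apply: eq_bigr => h _; rewrite !hornerE.
have F0 : \prod_(g : 'AEnd(L) | g \notin H) (P g - P 1%g) != 0.
  apply/prodf_neq0 => g gH; rewrite subr_eq0; apply: contraNneq gH => Pg.
  have : (P g).[theta] == 0.
    by rewrite Pg PE (bigD1 1%g) ?group1 // mulg1 AEnd1 subrr; apply/eqP/mul0r.
  rewrite PE => /prodf_eq0[h hH]; rewrite subr_eq0 => /eqP e.
  have /thetaI hg : (1%g : 'AEnd(L)) theta = (h * g)%g theta by rewrite AEnd1.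
  by rewrite -(groupMl _ hH) -hg group1.
have natI : injective (fun d : nat => d%:R : L).
  by move=> c d /(congr1 LC); rewrite !rmorph_nat => /eqP; rewrite eqr_nat => /eqP.
have [d Fd] := poly_nonroot F0 natI.
pose z g := LC (P g).[d%:R].
have nuz (nu : autC) : nu (z 1%g) = z (restr LC nu).
  rewrite /z restrE; congr (LC _); rewrite !PE rmorph_prod.
  by apply: eq_bigr => h _; rewrite rmorphB rmorph_nat mulg1 AEndM.
exists (z 1%g) => nu nuk; rewrite nuz; have := HP nu; rewrite nuk /=.
have [->|fnu] := eqVneq (f nu) 1%g => gH; split=> //.
  move=> _; rewrite /z !PE; congr (LC _).
  rewrite [RHS](reindex_inj (mulIg (restr LC nu))).
  by apply: eq_big => [h|h _]; [rewrite groupMr | rewrite mulg1].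
  move=> /(fmorph_inj LC) e; move: Fd.
  by rewrite horner_prod (bigD1 (restr LC nu)) ?gH //= hornerD hornerN e subrr mul0r eqxx.
by move=> f1; rewrite f1 eqxx in fnu.
Qed.

Section Realization.
Variables (k : fieldExtType rat) (iota : {rmorphism k -> algC}).
Variables (gT : finGroupType) (G : {group gT}) (abG : abelian G).
Variables (m : nat) (a : 'I_m -> k) (f : autC -> gT) (S : seq algC) (b : 'I_m -> algC).
Local Notation sk := (map iota (vbasis {:k})).
Hypothesis datum : norm_datum sk G (fun i => iota (a i)) f S b.

(** [K] is k(z) for the generator [z] of the field fixed by the kernel, and [f], applied to
    extensions to [algC], identifies its Galois group with [G]. *)
Lemma realization : exists K : splittingFieldType k,
  [/\ abelian_extension K, 'Gal({:K}%AS / 1%AS) \isog G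
    & forall i, is_norm_from K (a i)].
Proof.
have [fG fM fonto fS bP] := datum.
have [z zP] := kernel_generator sk fM fS.
have skE (nu : autC) : fixes sk nu <-> forall y, nu (iota y) = iota y.
  split=> [/fixesP nuk|nuk]; first exact: fix_basis.
  by apply/fixesP => _ /mapP[y _ ->].
have /fin_all_exists[lift liftP] h : exists nu : autC, h \in G -> fixes sk nu /\ f nu = h.
  have [hG|_] := boolP (h \in G); last by exists aut_id.
  by have [nu nuk fnu] := fonto h hG; exists nu.
have agree_ker b' : (forall nu : autC, fixes sk nu -> f nu = 1%g -> nu b' = b') ->
    forall mu nu : autC, fixes sk mu -> fixes sk nu -> f mu = f nu -> mu b' = nu b'.
  by move=> fixb mu nu; apply: (fixed_ker_agree fM fS fixb).
have z_agree (mu nu : autC) : fixes sk mu -> fixes sk nu -> mu z = nu z <-> f mu = f nu.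
  move=> muk nuk; split; last by apply: agree_ker => // nu' ? /zP->.
  move=> e; have cf : fixes sk (aut_comp (inv_aut nu) mu).
    apply/fixesP => x xk /=; rewrite (fixesP _ _ muk x xk).
    by rewrite -{1}(fixesP _ _ nuk x xk) algC_autK.
  have /(zP _ cf) : aut_comp (inv_aut nu) mu z = z by rewrite /= e algC_autK.
  rewrite fM (aut_morphV fM fS) => fmn; apply: (mulgI (f nu)^-1%g).
  by rewrite fmn mulVg.
have compk (mu nu : autC) : fixes sk mu -> fixes sk nu -> fixes sk (aut_comp mu nu).
  by move=> /fixesP muk /fixesP nuk; apply/fixesP => y yk /=; rewrite nuk ?muk.
have lift1 : lift 1%g z = z.
  by have [lk f1] := liftP _ (group1 G); apply/zP.
have lift_inj : {in G &, injective (fun h => lift h z)}.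
  move=> h h' /liftP[hk fh] /liftP[h'k fh'] e.
  by rewrite -fh -fh'; apply/z_agree.
pose P := \prod_(h in G) ('X - (lift h z)%:P).
have sP : size P = #|G|.+1 by rewrite /P -big_enum size_prod_XsubC -cardE.
(* An automorphism [nu] over [k] permutes the roots [lift h z] through left translation by
   [f nu]. *)
have fixP i (nu : autC) : (forall y, nu (iota y) = iota y) -> nu P`_i = P`_i.
  move=> /skE nuk; rewrite -coef_map; suff -> : map_poly nu P = P by [].
  rewrite rmorph_prod [RHS](reindex_inj (mulgI (f nu))) /=.
  apply: eq_big => [h|h hG]; first by rewrite groupMl.
  rewrite map_polyXsubC; congr ('X - _%:P).
  have [hk fh] := liftP h hG; have [h'k fh'] := liftP _ (groupM (fG nu) hG).
  rewrite -[LHS]/(aut_comp nu (lift h) z); apply/z_agree => //; first exact: compk.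
  by rewrite fM fh fh'.
have /fin_all_exists[rc rcE] (i : 'I_(size P)) : exists y, iota y = P`_i.
  by apply: num_field_fixed => nu; apply: fixP.
(* [P] pulled back to [k]; below [size P] the default 0 never occurs. *)
pose r := \poly_(i < size P) oapp rc 0 (insub i).
have rE : map_poly iota r = P.
  apply/polyP => i; rewrite coef_map coef_poly; case: ltnP => [ilt|/(nth_default 0)->].
    by rewrite insubT /= rcE.
  exact: rmorph0.
have rz : root (map_poly iota r) z.
  by rewrite rE rootE horner_prod (bigD1 1%g) //= lift1 !hornerE subrr mul0r.
have sr : size r = #|G|.+1 by rewrite -(size_map_poly iota) rE sP.
have r0 : r != 0 by rewrite -size_poly_gt0 sr.
(* With [z], a polynomial over [k] has all the [lift h z] as roots, and these are distinct. *)
have minr q : root (map_poly iota q) z -> q != 0 -> (size r <= size q)%N.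
  move=> qz q0; rewrite sr cardE -(size_map (fun h => lift h z)) -(size_map_poly iota q).
  apply: max_poly_roots; rewrite ?map_poly_eq0 //.
    apply/allP => _ /mapP[h + ->]; rewrite mem_enum => hG.
    have [/skE hk _] := liftP h hG.
    rewrite -(fmorph_root (lift h)) in qz; move: qz; rewrite -map_poly_comp.
    by rewrite (eq_map_poly hk).
  rewrite map_inj_in_uniq ?enum_uniq // => h h'.
  by rewrite !mem_enum; apply: lift_inj.
have [K0 [j [y [dimK jA jy genK]]]] := simple_extension r0 rz minr.
have jfix (nu : autC) : (forall x, nu (j x) = j x) -> fixes sk nu /\ f nu = 1%g.
  move=> nuj; have nuk : fixes sk nu by apply/skE => c; rewrite -jA nuj.
  by split=> //; apply/(zP _ nuk); rewrite -jy nuj.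
have /fin_all_exists[y_ y_E] h : exists yh, h \in G -> j yh = lift h z.
  have [hG|_] := boolP (h \in G); last by exists 0.
  have [|yh <-] := ext_field_fixed (j := j) (x := lift h z); last by exists yh.
  move=> nu /jfix[nuk fnu]; have [hk fh] := liftP h hG.
  rewrite -[LHS]/(aut_comp nu (lift h) z); apply/z_agree => //; first exact: compk.
  by rewrite fM fnu mul1g.
have ax : splitting_field_axiom K0.
  exists (map_poly (in_alg K0) r); first by apply/polyOver1P; exists r.
  exists [seq y_ h | h <- enum G].
    rewrite (_ : map_poly _ _ = \prod_(w <- [seq y_ h | h <- enum G]) ('X - w%:P)) ?eqpxx //.
    apply: (map_poly_inj j); rewrite -map_poly_comp (eq_map_poly jA) rE.
    rewrite big_map big_enum rmorph_prod; apply: eq_bigr => h hG.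
    by rewrite /= map_polyXsubC y_E.
  apply/vspaceP => x; rewrite memvf; have [q ->] := genK x.
  apply: rpred_horner.
    by apply/(polyOverS (subvP (subv_adjoin_seq _ _)))/polyOver1P; exists q.
  have -> : y = y_ 1%g by apply: (fmorph_inj j); rewrite y_E // lift1.
  by apply/seqv_sub_adjoin/map_f; rewrite mem_enum.
pose K : splittingFieldType k :=
  HB.pack_for (splittingFieldType k) K0 (FieldExt_isSplittingField.Build k K0 ax).
have galK : galois 1%AS {:K}%AS.
  apply/and3P; split; rewrite ?sub1v ?normalFieldf //.
  by apply/separableP => x _; apply: pcharf0_separable => p; rewrite !pchar_lalg pchar_num.
pose ext (g : gal_of {:K}) : autC := sval (ext_field_aut j g).
have extE g x : ext g (j x) = j (g x) by rewrite /ext (svalP (ext_field_aut j g)).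
have extk g : fixes sk (ext g).
  by apply/skE => c; rewrite -jA extE linearZ rmorph1.
pose phi g := f (ext g).
pose Ga := 'Gal({:K}%AS / 1%AS)%G.
(* Products in the Galois group and [aut_comp] run in opposite orders; the commutativity of [G]
   reconciles them. *)
have phiM : {in Ga &, {morph phi : g h / (g * h)%g}}.
  move=> g h _ _; rewrite /phi (centsP abG _ (fG _) _ (fG _)) -fM.
  apply/z_agree => //; first exact: compk.
  by rewrite -jy /= !extE galM ?memvf.
pose phim := Morphism phiM.
have injphi : ('injm phim)%g.
  apply/injmP => g h _ _ /= e; apply/eqP/gal_eqP => x _.
  have gy : g y = h y.
    by apply: (fmorph_inj j); rewrite -!extE jy; apply/z_agree.
  have galX (u : gal_of {:K}) (q : {poly k}) :
      u (map_poly (in_alg K) q).[y] = (map_poly (in_alg K) q).[u y].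
    rewrite -horner_map -map_poly_comp; congr _.[_]; apply: eq_map_poly => c /=.
    by rewrite linearZ rmorph1.
  by have [q ->] := genK x; rewrite !galX gy.
have imphi : (phim @* Ga = G)%g.
  apply/eqP; rewrite eqEcard card_injm // -(galois_dim galK) dimv1 divn1 dimK sr leqnn andbT.
  by apply/subsetP => _ /morphimP[g _ _ ->]; apply: fG.
have isoG : Ga \isog G by rewrite -imphi; apply: sub_isog.
exists K; split=> //.
  by split=> //; rewrite (isog_abelian isoG).
move=> i; have [b0 fixb bn] := bP i.
have [b' jb'] : exists b', j b' = b i.
  by apply: ext_field_fixed => nu /jfix[nuk fnu]; apply: fixb.
exists b'; first by rewrite -(fmorph_eq0 j) jb'.
apply: (fmorph_inj j); rewrite jA -(bn lift) // rmorph_prod.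
(* The identification of the two groups turns the product over [G] into the product of Galois
   conjugates. *)
have -> : \prod_(h in G) lift h (b i) = \prod_(g in Ga) lift (phi g) (b i).
  by rewrite -imphi morphimEdom big_imset //; apply/injmP.
apply: eq_bigr => g gG; rewrite -extE jb'.
have [hk fh] := liftP (phi g) (fG _).
by apply: (agree_ker (b i)).
Qed.

End Realization.

(** * The group of norms and the reduction to generators *)

Lemma norm_subgroup (k : fieldType) (K : splittingFieldType k) :
  mul_subgroup (fun a : k => is_norm_from K a).
Proof.
split.
- move=> a [b b0 ba]; apply: contraNneq b0 => a0.
  by rewrite -(galNorm_eq0 1%AS {:K}%AS) ba a0 scale0r.
- by exists 1; rewrite ?oner_neq0 // galNorm1 scale1r.
move=> a c [b b0 ba] [d d0 dc]; exists (b / d); first by rewrite mulf_neq0 ?invr_eq0.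
by rewrite galNormM galNormV ba dc -!in_algE fmorph_div.
Qed.

Theorem theorem1p1 (k : fieldExtType rat) (gT : finGroupType) (G : {group gT})
    (A : k -> Prop) (abG : abelian G) (fgA : fg_mul_subgroup A) :
  exists K : splittingFieldType k,
    [/\ abelian_extension K,
        'Gal({:K}%AS / 1%AS) \isog G
      & forall a : k, A a -> is_norm_from K a].
Proof.
have [_ [s [s0 As]]] := fgA.
have [iota0 [iotaB iotaM]] := num_field_embedding k.
pose iota : {rmorphism k -> algC} := HB.pack iota0
  (GRing.isZmodMorphism.Build _ _ iota0 iotaB)
  (GRing.isMonoidMorphism.Build _ _ iota0 iotaM).
pose a (i : 'I_(size s)) := s`_i.
have a0 i : iota (a i) != 0.
  by rewrite fmorph_eq0; apply: contraNneq s0 => <-; apply: mem_nth.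
have fixa i (nu : autC) : fixes (map iota (vbasis {:k})) nu -> nu (iota (a i)) = iota (a i).
  by move=> /fixesP nuk; apply: fix_basis.
have [f [S [b datum]]] := norm_datum_exists abG a0 fixa.
have [K [abK isoK normK]] := realization abG datum.
(* An element of [A] lies in every subgroup of k^* containing the generators, in particular in the
   group of norms. *)
exists K; split=> // c /As gen; apply: gen; first exact: norm_subgroup.
by move=> x /(nthP 0)[i ilt <-]; apply: (normK (Ordinal ilt)).
Qed.
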